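(* Let $S$ be a set, $\mathbb{K}$ a commutative ring, $\mathbf{M}$ an $S$-distributive $\mathbb{K}$-linear monoidal category, and $\mathbf{A},\mathbf{B}$ two $\mathbf{M}$-categories with object set $S$. Let $|\cdots|:S^3\to S$ be a function and let ${}_x\widetilde{R}_z^y:{}_xB_y\otimes{}_yA_z\to{}_xA_{|xyz|}\otimes{}_{|xyz|}B_z$ ($x,y,z\in S$) be morphisms in $\mathbf{M}$. Then the following four relations, for all $x,y,z,t\in S$, $${}_x\sigma_t^{|xy|yzt||}\circ({}_xA_{|xy|yzt||}\otimes{}_{|xy|yzt||}b_t^{|yzt|})\circ({}_x\widetilde{R}_{|yzt|}^y\otimes{}_{|yzt|}B_t)\circ({}_xB_y\otimes{}_y\widetilde{R}_t^z)={}_x\sigma_t^{|xzt|}\circ{}_x\widetilde{R}_t^z\circ({}_xb_z^y\otimes{}_zA_t),$$ $${}_x\sigma_t^{||xyz|zt|}\circ({}_xa_{||xyz|zt|}^{|xyz|}\otimes{}_{||xyz|zt|}B_t)\circ({}_xA_{|xyz|}\otimes{}_{|xyz|}\widetilde{R}_t^z)\circ({}_x\widetilde{R}_z^y\otimes{}_zA_t)={}_x\sigma_t^{|xyt|}\circ{}_x\widetilde{R}_t^y\circ({}_xB_y\otimes{}_ya_t^z),$$ $${}_x\sigma_y^{|xxy|}\circ{}_x\widetilde{R}_y^x\circ(1_x^B\otimes{}_xA_y)={}_x\sigma_y^y\circ({}_xA_y\otimes1_y^B),$$ $${}_x\sigma_y^{|xyy|}\circ{}_x\widetilde{R}_y^y\circ({}_xB_y\otimes1_y^A)={}_x\sigma_y^x\circ(1_x^A\otimes{}_xB_y)$$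 are equivalent to the following conditions, for all $x,y,z,t\in S$: (i) If $|xy|yzt||=|xzt|$, then $$({}_xA_{|xy|yzt||}\otimes{}_{|xy|yzt||}b_t^{|yzt|})\circ({}_x\widetilde{R}_{|yzt|}^y\otimes{}_{|yzt|}B_t)\circ({}_xB_y\otimes{}_y\widetilde{R}_t^z)={}_x\widetilde{R}_t^z\circ({}_xb_z^y\otimes{}_zA_t);$$ otherwise, each side of this identity is the zero map. (ii) If $||xyz|zt|=|xyt|$, then $$({}_xa_{||xyz|zt|}^{|xyz|}\otimes{}_{||xyz|zt|}B_t)\circ({}_xA_{|xyz|}\otimes{}_{|xyz|}\widetilde{R}_t^z)\circ({}_x\widetilde{R}_z^y\otimes{}_zA_t)={}_x\widetilde{R}_t^y\circ({}_xB_y\otimes{}_ya_t^z);$$ otherwise, each side of this identity is the zero map. (iii) If $|xxy|=y$, then ${}_x\widetilde{R}_y^x\circ(1_x^B\otimes{}_xA_y)={}_xA_y\otimes1_y^B$; otherwise, each side of this identity is the zero map. (iv) If $|xyy|=x$, then ${}_x\widetilde{R}_y^y\circ({}_xB_y\otimes1_y^A)=1_x^A\otimes{}_xB_y$; otherwise, each side of this identity is the zero map.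
   Context: $(\mathbf{M},\otimes,\mathbf{1})$ is a monoidal category; associativity and unit constraints are suppressed, and the identity morphism of an object $X$ is also denoted $X$. $\mathbf{M}$ is $\mathbb{K}$-linear if its hom-sets are $\mathbb{K}$-modules and both the composition and the tensor product of morphisms are $\mathbb{K}$-bilinear. $\mathbf{M}$ is $S$-distributive if every $S$-indexed family $\{X_i\}_{i\in S}$ of objects has a coproduct $(\bigoplus_{i\in S}X_i,\{\sigma_i\}_{i\in S})$ and, for every object $X$, $(X\otimes\bigoplus_iX_i,\{X\otimes\sigma_i\})$ and $((\bigoplus_iX_i)\otimes X,\{\sigma_i\otimes X\})$ are coproducts of $\{X\otimes X_i\}$ and $\{X_i\otimes X\}$. An $\mathbf{M}$-category $\mathbf{A}$ with object set $S$ consists of objects ${}_xA_y$ of $\mathbf{M}$ (playing the role of $\mathrm{Hom}(y,x)$), composition morphisms ${}_xa_z^y:{}_xA_y\otimes{}_yA_z\to{}_xA_z$ and identities $1_x^A:\mathbf{1}\to{}_xA_x$, satisfying the usual associativity and unit axioms; for $\mathbf{B}$ the data are ${}_xB_y,{}_xb_z^y,1_x^B$. The morphisms ${}_x\sigma_y^u:{}_xA_u\otimes{}_uB_y\to\bigoplus_{u\in S}{}_xA_u\otimes{}_uB_y$ are the canonical inclusions. *)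

(* Defs.v *)
(* MathComp; general (non-strict) monoidal categories, with the constraints
   written out wherever an informal formula suppresses them. *)
From HB Require Import structures.
From mathcomp Require Import all_boot all_algebra.

Set Implicit Arguments.
Unset Strict Implicit.
Unset Printing Implicit Defensive.

Import GRing.Theory.
Local Open Scope ring_scope.

Declare Scope cat_scope.
Delimit Scope cat_scope with cat.

Record category := Category {
  ob :> Type;
  mor : ob -> ob -> Type;
  idmor : forall X, mor X X;
  compm : forall X Y Z, mor Y Z -> mor X Y -> mor X Z;
  compm_idl : forall X Y (f : mor X Y), compm (idmor Y) f = f;
  compm_idr : forall X Y (f : mor X Y), compm f (idmor X) = f;
  compmA : forall X Y Z W (h : mor Z W) (g : mor Y Z) (f : mor X Y),
    compm h (compm g f) = compm (compm h g) f
}.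

Arguments mor {c} X Y.
Arguments idmor {c} X.

Notation "g ∘ f" := (compm g f) (at level 40, left associativity) : cat_scope.
Open Scope cat_scope.

(* [assoc], [lunit], [runit] are the constraints; the primed versions are
   their inverses. *)
Record monoidal_category := MonoidalCategory {
  mcat :> category;
  tens : mcat -> mcat -> mcat;
  tensm : forall X X' Y Y' : mcat,
    mor X X' -> mor Y Y' -> mor (tens X Y) (tens X' Y');
  munit : mcat;
  assoc : forall X Y Z : mcat, mor (tens (tens X Y) Z) (tens X (tens Y Z));
  assoc' : forall X Y Z : mcat, mor (tens X (tens Y Z)) (tens (tens X Y) Z);
  lunit : forall X : mcat, mor (tens munit X) X;
  lunit' : forall X : mcat, mor X (tens munit X);
  runit : forall X : mcat, mor (tens X munit) X;
  runit' : forall X : mcat, mor X (tens X munit);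
  tensm_id : forall X Y : mcat, tensm (idmor X) (idmor Y) = idmor (tens X Y);
  tensm_comp : forall (X X' X'' Y Y' Y'' : mcat)
      (f' : mor X' X'') (f : mor X X') (g' : mor Y' Y'') (g : mor Y Y'),
    tensm (f' ∘ f) (g' ∘ g) = tensm f' g' ∘ tensm f g;
  assocK : forall X Y Z : mcat, assoc' X Y Z ∘ assoc X Y Z = idmor _;
  assocK' : forall X Y Z : mcat, assoc X Y Z ∘ assoc' X Y Z = idmor _;
  lunitK : forall X : mcat, lunit' X ∘ lunit X = idmor _;
  lunitK' : forall X : mcat, lunit X ∘ lunit' X = idmor _;
  runitK : forall X : mcat, runit' X ∘ runit X = idmor _;
  runitK' : forall X : mcat, runit X ∘ runit' X = idmor _;
  assoc_nat : forall (X X' Y Y' Z Z' : mcat)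
      (f : mor X X') (g : mor Y Y') (h : mor Z Z'),
    assoc X' Y' Z' ∘ tensm (tensm f g) h = tensm f (tensm g h) ∘ assoc X Y Z;
  lunit_nat : forall (X X' : mcat) (f : mor X X'),
    lunit X' ∘ tensm (idmor munit) f = f ∘ lunit X;
  runit_nat : forall (X X' : mcat) (f : mor X X'),
    runit X' ∘ tensm f (idmor munit) = f ∘ runit X;
  pentagon : forall X Y Z W : mcat,
    assoc X Y (tens Z W) ∘ assoc (tens X Y) Z W =
    tensm (idmor X) (assoc Y Z W) ∘ assoc X (tens Y Z) W
      ∘ tensm (assoc X Y Z) (idmor W);
  triangle : forall X Y : mcat,
    tensm (idmor X) (lunit Y) ∘ assoc X munit Y = tensm (runit X) (idmor Y)
}.

Arguments tens {m} X Y.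
Arguments munit {m}.
Arguments assoc {m} X Y Z.
Arguments assoc' {m} X Y Z.
Arguments lunit {m} X.
Arguments lunit' {m} X.
Arguments runit {m} X.
Arguments runit' {m} X.

Notation "X ⊗ Y" := (tens X Y) (at level 38, left associativity) : cat_scope.
Notation "f ⊠ g" := (tensm f g) (at level 38, left associativity) : cat_scope.
Notation "'𝟏'" := munit (at level 0) : cat_scope.

(* The library's [bilinear_for] requires a nonzero base ring. *)
Definition bilinear_map (K : comPzRingType) (U V W : lmodType K)
    (f : U -> V -> W) : Prop :=
  (forall u, linear (f u)) /\ (forall v, linear (fun u => f u v)).

Record linear_monoidal_category (K : comPzRingType) := LinearMonoidalCategory {
  lmcat :> monoidal_category;
  mor_lmod : forall X Y : lmcat, GRing.Lmodule K (mor X Y);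
  lmmor := fun X Y : lmcat => GRing.Lmodule.Pack (mor_lmod X Y);
  compm_bilinear : forall X Y Z : lmcat,
    bilinear_map (@compm lmcat X Y Z : lmmor Y Z -> lmmor X Y -> lmmor X Z);
  tensm_bilinear : forall X X' Y Y' : lmcat,
    bilinear_map
      (@tensm lmcat X X' Y Y' :
         lmmor X X' -> lmmor Y Y' -> lmmor (X ⊗ Y) (X' ⊗ Y'))
}.

HB.instance Definition _ (K : comPzRingType) (M : linear_monoidal_category K)
  (X Y : M) : GRing.Lmodule K (@mor M X Y) := mor_lmod X Y.

Definition is_coproduct (C : category) (S : Type) (X : S -> C) (P : C)
    (s : forall i, mor (X i) P) : Prop :=
  forall (Y : C) (f : forall i, mor (X i) Y),
    exists! h : mor P Y, forall i, h ∘ s i = f i.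

Arguments is_coproduct {C S} X P s.

Record distributive (S : Type) (M : monoidal_category) := Distributive {
  coprod : (S -> M) -> M;
  incl : forall (X : S -> M) (i : S), mor (X i) (coprod X);
  coprodP : forall X : S -> M, is_coproduct X (coprod X) (incl X);
  tens_coprodP : forall (Y : M) (X : S -> M),
    is_coproduct (fun i => Y ⊗ X i) (Y ⊗ coprod X)
      (fun i => idmor Y ⊠ incl X i);
  coprod_tensP : forall (Y : M) (X : S -> M),
    is_coproduct (fun i => X i ⊗ Y) (coprod X ⊗ Y)
      (fun i => incl X i ⊠ idmor Y)
}.

Arguments incl {S M} d X i.

(* [A x y] plays the role of Hom(y, x), and
   [ecomp A x y z : A x y ⊗ A y z -> A x z]. *)
Record enriched_category (M : monoidal_category) (S : Type) :=
  EnrichedCategory {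
  ehom :> S -> S -> M;
  ecomp : forall x y z, mor (ehom x y ⊗ ehom y z) (ehom x z);
  eid : forall x, mor 𝟏 (ehom x x);
  ecompA : forall x y z t,
    ecomp x z t ∘ (ecomp x y z ⊠ idmor (ehom z t)) =
    ecomp x y t ∘ (idmor (ehom x y) ⊠ ecomp y z t) ∘ assoc _ _ _;
  ecomp_idl : forall x y,
    ecomp x x y ∘ (eid x ⊠ idmor (ehom x y)) = lunit (ehom x y);
  ecomp_idr : forall x y,
    ecomp x y y ∘ (idmor (ehom x y) ⊠ eid y) = runit (ehom x y)
}.

Arguments ecomp {M S} e x y z.
Arguments eid {M S} e x.

Section Relations.
Context (S : Type) (M : monoidal_category) (A B : enriched_category M S).

(* [br x y z] is |xyz|. *)
Context (br : S -> S -> S -> S)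
  (R : forall x y z : S,
     mor (B x y ⊗ A y z) (A x (br x y z) ⊗ B (br x y z) z)).

Definition canonical_incl (D : distributive S M) (x y u : S) :
    mor (A x u ⊗ B u y) (coprod D (fun u => A x u ⊗ B u y)) :=
  incl D (fun u => A x u ⊗ B u y) u.

(* For e : u = v, view a morphism into A x u ⊗ B u y as one into
   A x v ⊗ B v y; this is what makes the two sides of the relations
   comparable when their indices agree. *)
Definition transport_mid (X : M) (x y u v : S) (e : u = v)
    (f : mor X (A x u ⊗ B u y)) : mor X (A x v ⊗ B v y) :=
  eq_rect u (fun w => mor X (A x w ⊗ B w y)) f v e.

Definition compB_lhs (x y z t : S) :
    mor ((B x y ⊗ B y z) ⊗ A z t)
        (A x (br x y (br y z t)) ⊗ B (br x y (br y z t)) t) :=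
  (idmor (A x (br x y (br y z t)))
     ⊠ ecomp B (br x y (br y z t)) (br y z t) t)
  ∘ assoc _ _ _
  ∘ (R x y (br y z t) ⊠ idmor (B (br y z t) t))
  ∘ assoc' _ _ _
  ∘ (idmor (B x y) ⊠ R y z t)
  ∘ assoc _ _ _.

Definition compB_rhs (x y z t : S) :
    mor ((B x y ⊗ B y z) ⊗ A z t) (A x (br x z t) ⊗ B (br x z t) t) :=
  R x z t ∘ (ecomp B x y z ⊠ idmor (A z t)).

Definition compA_lhs (x y z t : S) :
    mor ((B x y ⊗ A y z) ⊗ A z t)
        (A x (br (br x y z) z t) ⊗ B (br (br x y z) z t) t) :=
  (ecomp A x (br x y z) (br (br x y z) z t)
     ⊠ idmor (B (br (br x y z) z t) t))
  ∘ assoc' _ _ _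
  ∘ (idmor (A x (br x y z)) ⊠ R (br x y z) z t)
  ∘ assoc _ _ _
  ∘ (R x y z ⊠ idmor (A z t)).

Definition compA_rhs (x y z t : S) :
    mor ((B x y ⊗ A y z) ⊗ A z t) (A x (br x y t) ⊗ B (br x y t) t) :=
  R x y t ∘ (idmor (B x y) ⊠ ecomp A y z t) ∘ assoc _ _ _.

(* In the unit relations the source is A x y (resp. B x y), identified with
   its tensor product with 𝟏. *)
Definition unitB_lhs (x y : S) :
    mor (A x y) (A x (br x x y) ⊗ B (br x x y) y) :=
  R x x y ∘ (eid B x ⊠ idmor (A x y)) ∘ lunit' (A x y).

Definition unitB_rhs (x y : S) : mor (A x y) (A x y ⊗ B y y) :=
  (idmor (A x y) ⊠ eid B y) ∘ runit' (A x y).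

Definition unitA_lhs (x y : S) :
    mor (B x y) (A x (br x y y) ⊗ B (br x y y) y) :=
  R x y y ∘ (idmor (B x y) ⊠ eid A y) ∘ runit' (B x y).

Definition unitA_rhs (x y : S) : mor (B x y) (A x x ⊗ B x y) :=
  (eid A x ⊠ idmor (B x y)) ∘ lunit' (B x y).

End Relations.

(* Main.v *)
(* In a linear category the inclusion [s u] into a coproduct has a left inverse
   killing every other inclusion, by the universal property applied to the
   family that is the identity at [u] and zero elsewhere.  So [s u ∘ f = s v ∘ g]
   means [f = g] when [u = v], and [f = g = 0] otherwise. *)

Require Import Defs.
From HB Require Import structures.
From mathcomp Require Import all_boot all_algebra.
From mathcomp Require Import boolp.

Set Implicit Arguments.
Unset Strict Implicit.
Unset Printing Implicit Defensive.

Import GRing.Theory.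
Local Open Scope ring_scope.
Local Open Scope cat_scope.

Section CoproductInLinearCategory.
Context (K : comPzRingType) (M : linear_monoidal_category K).

Lemma compm0 (X Y Z : M) (h : mor Y Z) : h ∘ (0 : mor X Y) = 0.
Proof.
have [lin_r _] := compm_bilinear X Y Z.
(* Linearity at the scalar [-1] and the vectors [0], [0] reads [h ∘ 0 = - (h ∘ 0) + h ∘ 0]. *)
by have := lin_r h (-1) 0 0; rewrite scaler0 addr0 scaleN1r addNr.
Qed.

Lemma comp0m (X Y Z : M) (f : mor X Y) : (0 : mor Y Z) ∘ f = 0.
Proof.
have [_ lin_l] := compm_bilinear X Y Z.
by have := lin_l f (-1) 0 0; rewrite scaler0 addr0 scaleN1r addNr.
Qed.

Context (S : Type) (X : S -> M) (P : M) (s : forall i, mor (X i) P).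
Hypothesis sP : is_coproduct X P s.

Lemma coproduct_proj (u : S) :
  exists p : mor P (X u),
    p ∘ s u = idmor (X u) /\ forall v, v <> u -> p ∘ s v = 0.
Proof.
(* [S] is an arbitrary type, so [v = u] is decided classically; the identity must be cast along the
   proof obtained. *)
pose F v : mor (X v) (X u) :=
  if pselect (v = u) is left e
  then eq_rect v (fun w => mor (X v) (X w)) (idmor (X v)) u e else 0.
have [p [pF _]] := sP F.
exists p; split=> [|v ne_vu]; rewrite pF /F; case: pselect => // e.
(* Here [e : u = u]; by proof irrelevance the cast along it is trivial. *)
by rewrite (Prop_irrelevance e erefl).
Qed.

(** The codomains of [f] and [g] agree only up to a proof of [u = v], hence the cast; its clause is
    vacuous when [u <> v]. *)
Lemma incl_comp_eqP (Y : M) (u v : S) (f : mor Y (X u)) (g : mor Y (X v)) :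
  s u ∘ f = s v ∘ g <->
  (forall e : u = v, eq_rect u (fun w => mor Y (X w)) f v e = g) /\
  (u <> v -> f = 0 /\ g = 0).
Proof.
split=> [eq_fg | [eq_fg zero_fg]]; last first.
  have [e | ne_uv] := pselect (u = v).
    by rewrite -(eq_fg e); case: v / e {g eq_fg zero_fg}.
  by have [-> ->] := zero_fg ne_uv; rewrite !compm0.
have [p [p_u p_ne_u]] := coproduct_proj u.
have [q [q_v q_ne_v]] := coproduct_proj v.
(* Each of [f] and [g] factors through the other, via [p ∘ s v] and [q ∘ s u]; both connecting maps
   vanish when [u <> v]. *)
have pf : f = (p ∘ s v) ∘ g by rewrite -compmA -eq_fg compmA p_u compm_idl.
have qg : g = (q ∘ s u) ∘ f by rewrite -compmA eq_fg compmA q_v compm_idl.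
split=> [e | ne_uv]; last first.
  by split; [rewrite pf p_ne_u ?comp0m //; exact: nesym | rewrite qg q_ne_v ?comp0m].
(* With [v] replaced by [u], [q_v] makes the connecting map [q ∘ s u] the identity, so [qg] becomes
   [g = f]. *)
by case: v / e g q q_v {eq_fg q_ne_v pf} qg => g q -> ->; rewrite compm_idl.
Qed.

End CoproductInLinearCategory.

Theorem corollary2p9 (S : Type) (K : comPzRingType)
  (M : linear_monoidal_category K) (D : distributive S M)
  (A B : enriched_category M S) (br : S -> S -> S -> S)
  (R : forall x y z : S,
     mor (B x y ⊗ A y z) (A x (br x y z) ⊗ B (br x y z) z)) :
  let σ := canonical_incl A B D in
  [/\ forall x y z t,
        σ x t (br x y (br y z t)) ∘ compB_lhs R x y z t
        = σ x t (br x z t) ∘ compB_rhs R x y z t,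
      forall x y z t,
        σ x t (br (br x y z) z t) ∘ compA_lhs R x y z t
        = σ x t (br x y t) ∘ compA_rhs R x y z t,
      forall x y,
        σ x y (br x x y) ∘ unitB_lhs R x y = σ x y y ∘ unitB_rhs A B x y
    & forall x y,
        σ x y (br x y y) ∘ unitA_lhs R x y = σ x y x ∘ unitA_rhs A B x y]
  <->
  [/\ forall x y z t,
        (forall e : br x y (br y z t) = br x z t,
           transport_mid e (compB_lhs R x y z t) = compB_rhs R x y z t) /\
        (br x y (br y z t) <> br x z t ->
           compB_lhs R x y z t = 0 /\ compB_rhs R x y z t = 0),
      forall x y z t,
        (forall e : br (br x y z) z t = br x y t,
           transport_mid e (compA_lhs R x y z t) = compA_rhs R x y z t) /\
        (br (br x y z) z t <> br x y t ->
           compA_lhs R x y z t = 0 /\ compA_rhs R x y z t = 0),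
      forall x y,
        (forall e : br x x y = y,
           transport_mid e (unitB_lhs R x y) = unitB_rhs A B x y) /\
        (br x x y <> y ->
           unitB_lhs R x y = 0 /\ unitB_rhs A B x y = 0)
    & forall x y,
        (forall e : br x y y = x,
           transport_mid e (unitA_lhs R x y) = unitA_rhs A B x y) /\
        (br x y y <> x ->
           unitA_lhs R x y = 0 /\ unitA_rhs A B x y = 0)].
Proof.
move=> σ.
have σP x y u v Y (f : mor Y (A x u ⊗ B u y)) (g : mor Y (A x v ⊗ B v y)) :
    σ x y u ∘ f = σ x y v ∘ g <->
    (forall e : u = v, transport_mid e f = g) /\ (u <> v -> f = 0 /\ g = 0).
  (* For fixed [x] and [y] the summands are indexed by the middle object [w], and [transport_mid]
     unfolds to the cast of the lemma. *)
  exact: (incl_comp_eqP (@coprodP _ _ D (fun w => A x w ⊗ B w y)) f g).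
by split=> -[r1 r2 r3 r4]; split=> *; apply/σP.
Qed.
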